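(* If $\vec{\mathtt e}:L^p(\mathbb R^d)\to\mathbb R^d$ is a $\sigma(L^p,L^q)$-lower semicontinuous vector-valued sublinear expectation, then $$\vec{\mathtt e}(\xi)=(\mathtt e_1(\xi_1),\dots,\mathtt e_d(\xi_d)),\qquad \xi=(\xi_1,\dots,\xi_d)\in L^p(\mathbb R^d),$$ for a collection of numerical sublinear expectations $\mathtt e_1,\dots,\mathtt e_d$ on $L^p(\mathbb R)$.
   Context: Fix a probability space, $p\in[1,\infty]$ and $q$ with $1/p+1/q=1$. $L^p(\mathbb R^d)$ is the space of $p$-integrable random vectors (essentially bounded if $p=\infty$) with the topology $\sigma(L^p,L^q)$ from the pairing $\mathbf E\langle\xi,\zeta\rangle$. Inequalities between vectors are coordinatewise, and lower semicontinuity of $\vec{\mathtt e}$ is that of each of its coordinates. A vector-valued sublinear expectation is a function $\vec{\mathtt e}:L^p(\mathbb R^d)\to\mathbb R^d$ such that $\vec{\mathtt e}(x)=x$ for all deterministic $x\in\mathbb R^d$; $\vec{\mathtt e}(\xi)\le\vec{\mathtt e}(\eta)$ if $\xi\le\eta$ a.s.; $\vec{\mathtt e}(c\xi)=c\,\vec{\mathtt e}(\xi)$ for all $c\ge0$; and $\vec{\mathtt e}(\xi+\eta)\le\vec{\mathtt e}(\xi)+\vec{\mathtt e}(\eta)$. A numerical sublinear expectation is a real-valued function $\mathtt e$ on $L^p(\mathbb R)$ such that $\mathtt e(\beta+a)=\mathtt e(\beta)+a$ for deterministic $a$; $\mathtt e(\beta)\le\mathtt e(\beta')$ if $\beta\le\beta'$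 a.s.; $\mathtt e(c\beta)=c\,\mathtt e(\beta)$ for $c\ge0$; and $\mathtt e(\beta+\beta')\le\mathtt e(\beta)+\mathtt e(\beta')$. *)

(* Defs.v *)
From HB Require Import structures.
From mathcomp Require Import all_boot all_order all_algebra.
From mathcomp Require Import all_classical reals ereal topology normedtype.
From mathcomp Require Import sequences exp numfun measure measurable_realfun.
From mathcomp Require Import lebesgue_measure ess_sup_inf lebesgue_integral.
From mathcomp Require Import hoelder probability.

Set Implicit Arguments.
Unset Strict Implicit.
Unset Printing Implicit Defensive.

Import Order.TTheory GRing.Theory Num.Def Num.Theory.
Import numFieldNormedType.Exports.

Local Open Scope classical_set_scope.
Local Open Scope ring_scope.

Section finite_norm_extra.
Context (disp : measure_display) (T : measurableType disp) (R : realType).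
Variables (P : probability T R) (p : \bar R).
Hypothesis p1 : (1 <= p)%E.

Lemma le_finite_norm (f g : T -> R) :
  measurable_fun setT f -> measurable_fun setT g ->
  (forall t, `|f t| <= `|g t|) -> finite_norm P p g -> finite_norm P p f.
Proof.
move=> mf mg fg; apply: le_lt_trans; rewrite unlock.
case: p p1 => [r r1| _|//].
- have r0 : 0 < r by rewrite (lt_le_trans ltr01).
  rewrite gt0_ler_poweR ?invr_gt0//.
  + by rewrite ltW ?invr_gt0.
  + by rewrite in_itv/= leey integral_ge0.
  + by rewrite in_itv/= leey integral_ge0.
  have mr (h : T -> R) : measurable_fun setT h ->
      measurable_fun setT (EFin \o (fun t => `|h t| `^ r)).
    move=> mh; apply/measurable_EFinP.
    apply: (@measurableT_comp _ _ _ _ _ _ (@powR R ^~ r)) => //.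
    exact: measurableT_comp.
  apply: ge0_le_integral => //.
  + by move=> t _; exact: poweR_ge0.
  + exact: mr.
  + exact: mr.
  + by move=> t _; rewrite /= lee_fin ge0_ler_powR// ?nnegrE// ltW.
- case: ifPn => // _; apply: le_ess_sup.
  by apply/nearW => t /=; rewrite lee_fin.
Qed.

Lemma Lfun_cstP (a : R) : cst a \in Lfun P p.
Proof.
rewrite inE; apply/andP; split; rewrite inE//= /finite_norm.
case: p p1 => [r r1| _|//].
- by have := Lfun_cst P a r; rewrite inE => /andP[_]; rewrite inE.
- rewrite unlock; case: ifPn => // P0.
  rewrite (_ : abse \o _ = cst `|a|%:E); last by apply/funext.
  by rewrite ess_sup_cst ?ltry.
Qed.

Lemma Lfun_normP (f : T -> R) : f \in Lfun P p -> normr \o f \in Lfun P p.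
Proof.
rewrite !inE => /andP[/[!inE] mf lf].
have mnf : measurable_fun setT (normr \o f) by exact: measurableT_comp.
apply/andP; rewrite !inE; split=> //.
by apply: le_finite_norm lf => // t /=; rewrite normr_id.
Qed.

End finite_norm_extra.

(* `|xi t| is the maximum norm of the library on 'rV_d; all norms on R^d give
   the same space. *)
Definition Lvec_pred (disp : measure_display) (T : measurableType disp)
    (R : realType) (P : probability T R) (p : \bar R) (d : nat)
    : {pred T -> 'rV[R]_d} :=
  mem [set xi : T -> 'rV[R]_d |
    (forall i, measurable_fun setT (fun t => xi t 0 i)) /\
    finite_norm P p (fun t => `|xi t|)].
Arguments Lvec_pred {disp T R} P p {d} _.

(* Like the library's LfunType, this is a space of functions and not of classes
   modulo almost sure equality. The maps below that are monotone for the almost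
   sure order are constant on these classes, and the topology sigma(L^p, L^q)
   does not separate almost surely equal elements. *)
Record Lvec (disp : measure_display) (T : measurableType disp) (R : realType)
    (P : probability T R) (p : \bar R) (p1 : (1 <= p)%E) (d : nat) := MkLvec {
  Lvec_fun :> T -> 'rV[R]_d ;
  Lvec_funP : Lvec_fun \in Lvec_pred P p }.

Section Lvec_theory.
Context (disp : measure_display) (T : measurableType disp) (R : realType).
Variables (P : probability T R) (p : \bar R) (p1 : (1 <= p)%E) (d : nat).

Lemma le_coord_norm (x : 'rV[R]_d) i : `|x 0 i| <= `|x|.
Proof.
rewrite [leRHS]/Num.norm/= mx_normrE.
exact: (le_bigmax _ (fun ij : 'I_1 * 'I_d => `|x ij.1 ij.2|) (0, i)).
Qed.

Lemma norm_le_sum (x : 'rV[R]_d) : `|x| <= \sum_i `|x 0 i|.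
Proof.
rewrite [leLHS]/Num.norm/= mx_normrE; apply/bigmax_leP; split=> [|[i j] _].
  by rewrite sumr_ge0.
by rewrite (ord1 i)/= (bigD1 j)//= lerDl sumr_ge0.
Qed.

Lemma measurable_rV_norm (xi : T -> 'rV[R]_d) :
  (forall i, measurable_fun setT (fun t => xi t 0 i)) ->
  measurable_fun setT (fun t => `|xi t|).
Proof.
move=> mxi; rewrite [X in measurable_fun _ X](_ : _ =
    fun t => \big[Num.max/0]_(ij : 'I_1 * 'I_d) `|xi t ij.1 ij.2|); last first.
  by apply/funext => t; rewrite [LHS]/Num.norm/= mx_normrE.
elim: (index_enum _) => [|[i j] s IH].
  rewrite (_ : (fun _ => _) = cst 0); first exact: measurable_cst.
  by apply/funext => t; rewrite big_nil.
rewrite (_ : (fun _ => _) = fun t => Num.max `|xi t i j|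
    (\big[Num.max/0]_(ij <- s) `|xi t ij.1 ij.2|)); last first.
  by apply/funext => t; rewrite big_cons.
apply: measurable_maxr => //=; rewrite (ord1 i).
by apply: measurableT_comp => //; exact: mxi.
Qed.

Lemma Lvec_predP (xi : T -> 'rV[R]_d) :
  xi \in Lvec_pred P p <-> forall i, (fun t => xi t 0 i) \in Lfun P p.
Proof.
split=> [|xiL].
  rewrite inE => -[mxi nxi] i; rewrite inE; apply/andP; rewrite !inE; split.
    exact: mxi.
  apply: (@le_finite_norm _ _ _ _ _ p1 _ _ _ _ _ nxi) => //=.
    exact: measurable_rV_norm.
  by move=> t; rewrite normr_id le_coord_norm.
have mxi i : measurable_fun setT (fun t => xi t 0 i).
  by have := xiL i; rewrite inE => /andP[/[!inE]].
rewrite inE; split=> //.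
have : \sum_i (normr \o (fun t => xi t 0 i)) \in Lfun P p.
  apply: (big_ind (fun h : T -> R => h \in Lfun P p)) => [||i _].
  - by have [] := Lfun_addr_closed P p1.
  - by have [_] := Lfun_addr_closed P p1; apply.
  - exact: Lfun_normP.
rewrite inE => /andP[/[!inE] ms ns].
apply: (le_finite_norm p1 _ ms _ ns); first exact: measurable_rV_norm.
move=> t; rewrite normr_id (le_trans (norm_le_sum _))// fct_sumE.
exact: ler_norm.
Qed.

HB.instance Definition _ := [isSub for @Lvec_fun _ _ _ P p p1 d].
HB.instance Definition _ := [Choice of Lvec P p1 d by <:].

Lemma Lvec_submod_closed : submod_closed (@Lvec_pred _ _ _ P p d).
Proof.
have [L0 LD] := Lfun_submod_closed P p1.
split=> [|a f g /Lvec_predP Lf /Lvec_predP Lg]; apply/Lvec_predP => i.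
  by rewrite (_ : (fun _ => _) = 0)//; apply/funext => t; rewrite mxE.
rewrite (_ : (fun _ => _) = a *: (fun t => f t 0 i) + (fun t => g t 0 i)).
  exact: LD.
by apply/funext => t; rewrite /= !mxE.
Qed.

HB.instance Definition _ := GRing.isSubmodClosed.Build _ _
  (@Lvec_pred _ _ _ P p d) Lvec_submod_closed.
HB.instance Definition _ := [SubChoice_isSubLmodule of Lvec P p1 d by <:].

Definition LfunType_cst (a : R) : LfunType P p1 := Lfun_Sub p1 (Lfun_cstP P p1 a).

Lemma Lvec_cst_subproof (x : 'rV[R]_d) : cst x \in Lvec_pred P p.
Proof. by apply/Lvec_predP => i; exact: Lfun_cstP. Qed.

Definition Lvec_cst (x : 'rV[R]_d) : Lvec P p1 d := MkLvec p1 (Lvec_cst_subproof x).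

Lemma Lvec_coord_subproof (xi : Lvec P p1 d) i :
  (fun t => xi t 0 i) \in Lfun P p.
Proof. by move: i; apply/Lvec_predP; exact: Lvec_funP. Qed.

Definition Lvec_coord (xi : Lvec P p1 d) (i : 'I_d) : LfunType P p1 :=
  Lfun_Sub p1 (Lvec_coord_subproof xi i).

End Lvec_theory.

Section sublinear.
Context (disp : measure_display) (T : measurableType disp) (R : realType).
Variables (P : probability T R) (p : \bar R) (p1 : (1 <= p)%E).

Record vector_sublinear_expectation (d : nat)
    (e : Lvec P p1 d -> 'rV[R]_d) : Prop := {
  vse_cst : forall x, e (Lvec_cst P p1 x) = x ;
  vse_mono : forall xi eta : Lvec P p1 d,
    (\forall t \ae P, forall i, xi t 0 i <= eta t 0 i) ->
    forall i, e xi 0 i <= e eta 0 i ;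
  vse_pos_homog : forall (c : R) xi, 0 <= c -> e (c *: xi) = c *: e xi ;
  vse_subadd : forall xi eta i, e (xi + eta) 0 i <= e xi 0 i + e eta 0 i }.

Record sublinear_expectation (e : LfunType P p1 -> R) : Prop := {
  se_translation : forall b a, e (b + LfunType_cst P p1 a) = e b + a ;
  se_mono : forall b b' : LfunType P p1,
    (\forall t \ae P, b t <= b' t) -> e b <= e b' ;
  se_pos_homog : forall (c : R) b, 0 <= c -> e (c *: b) = c * e b ;
  se_subadd : forall b b', e (b + b') <= e b + e b' }.

Variables (q : \bar R) (q1 : (1 <= q)%E) (d : nat).

(* For conjugate p and q the expectation is finite, by Hoelder's inequality, so
   that fine loses nothing. *)
Definition Lvec_pairing (xi : Lvec P p1 d) (zeta : Lvec P q1 d) : R :=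
  fine 'E_P[fun t => \sum_i xi t 0 i * zeta t 0 i].

(* The coarsest topology on L^p(R^d) for which every functional
   xi |-> Lvec_pairing xi zeta is continuous. *)
Definition sigma_topology : topologicalType :=
  initial_topology (Lvec_pairing : Lvec P p1 d -> {ptws Lvec P q1 d -> R}).

End sublinear.

(* Main.v *)
Require Import Defs.
From HB Require Import structures.
From mathcomp Require Import all_boot all_order all_algebra.
From mathcomp Require Import all_classical reals ereal topology normedtype.
From mathcomp Require Import sequences exp numfun measure measurable_realfun.
From mathcomp Require Import lebesgue_measure ess_sup_inf lebesgue_integral.
From mathcomp Require Import hoelder probability.

Import Order.TTheory GRing.Theory Num.Def Num.Theory.
Import numFieldNormedType.Exports.

Local Open Scope classical_set_scope.
Local Open Scope ring_scope.

(** Each coordinate [e_i] of the expectation depends on [xi_i] only.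

    By subadditivity, [e_i xi <= e_i eta + e_i (xi - eta)], so it is enough that
    [e_i xi <= 0] whenever [xi_i = 0] ([vse_zero_coord_le0]). If such a [xi] is
    bounded by [n], then [xi] lies below the deterministic vector with
    coordinate [0] at [i] and [n] elsewhere, on which [e_i] is [0]; monotonicity
    concludes. A general [xi] is the sigma(L^p, L^q)-limit of its coordinatewise
    truncations at level [n] ([cvg_Lvec_truncate]), which are bounded and still
    vanish at coordinate [i], so the bound passes to [xi] by lower
    semicontinuity. The convergence of the truncations against any [zeta] in L^q
    is dominated convergence, the integrable bound coming from Hoelder's
    inequality ([integrable_mul_Lfun]).

    Once [e_i xi] is known to depend on [xi_i] only, [xi] may be replaced by the
    vector all of whose coordinates are [xi_i]; so [e_i] evaluated on the
    diagonal vectors [(b, ..., b)] is the required numerical expectation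
    ([sublinear_expectation_diag]). *)

(** * Convergence in initial topologies and lower semicontinuity *)

Lemma cvg_initial {S : choiceType} {U : topologicalType} (f : S -> U)
    (F : set_system S) (s : S) : Filter F ->
  f @ F --> f s -> F --> (s : initial_topology f).
Proof.
move=> FF fF A /= [_ [[B Bop <-] Bfs sBfA]].
apply: (filterS sBfA); apply: fF.
by apply: open_nbhs_nbhs.
Qed.

(** Stated for an arbitrary index type, with no topology on it: the pointwise
    topology is a supremum of initial topologies of evaluations. *)
Lemma cvg_ptws {U : Type} {V : topologicalType} (F : set_system (U -> V))
    (f : U -> V) : Filter F ->
  (forall u, g u @[g --> F] --> f u) -> F --> (f : {ptws U -> V}).
Proof.
move=> FF Ff; apply/cvg_sup => u; apply: cvg_initial; exact: Ff.
Qed.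

Lemma lower_semicontinuous_cvg_le {X : topologicalType} {R : realFieldType}
    (f : X -> \bar R) (u : nat -> X) (x : X) (a : R) :
  lower_semicontinuous f -> u @ \oo --> x ->
  (forall n, (f (u n) <= a%:E)%E) -> (f x <= a%:E)%E.
Proof.
move=> lsc ux ua; rewrite leNgt; apply/negP => /lsc[V xV Va].
have [n _ /(_ n (leqnn n)) /Va] := ux _ xV.
by rewrite ltNge ua.
Qed.

(** * Truncation of real numbers *)

Section truncation.
Context {R : realType}.
Implicit Types (M x : R).

Definition truncate M x := Num.max (- M) (Num.min M x).

Lemma norm_truncate_le_bound M x : 0 <= M -> `|truncate M x| <= M.
Proof.
move=> M0; rewrite ler_norml /truncate le_max lexx/= ge_max ge_min lexx/=.
by rewrite andbT (le_trans _ M0)// oppr_le0.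
Qed.

Lemma truncate_id M x : `|x| <= M -> truncate M x = x.
Proof.
by rewrite ler_norml /truncate => /andP[Mx xM]; rewrite min_r// max_r.
Qed.

Lemma norm_truncate_le M x : 0 <= M -> `|truncate M x| <= `|x|.
Proof.
move=> M0; have [xM|/ltW Mx] := leP `|x| M; first by rewrite truncate_id.
exact: le_trans (norm_truncate_le_bound _ _ M0) Mx.
Qed.

Lemma cvg_truncate x : truncate n%:R x @[n --> \oo] --> x.
Proof.
apply: cvg_near_cst; near=> n; apply: truncate_id.
near: n; exact: nbhs_infty_ger.
Unshelve. all: by end_near. Qed.

End truncation.

(** * Products of functions in conjugate spaces *)

Section Lfun_product.
Context {disp : measure_display} {T : measurableType disp} {R : realType}.
Variable P : probability T R.

Lemma Lfun_measurable (p : \bar R) (f : T -> R) :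
  f \in Lfun P p -> measurable_fun setT f.
Proof. by rewrite inE => /andP[/[!inE]]. Qed.

Lemma Lfun_finite_norm (p : \bar R) (f : T -> R) :
  f \in Lfun P p -> finite_norm P p f.
Proof. by rewrite inE => /andP[_ /[!inE]]. Qed.

Lemma Lfuny_bounded (f : T -> R) : f \in Lfun P +oo%E ->
  exists M : R, {ae P, forall t, `|f t| <= M}.
Proof.
have P0 : (0 < P setT)%E by rewrite probability_setT.
move/Lfun_finite_norm; rewrite /finite_norm unlock ifT; last exact: P0.
exact: ess_supr_bounded.
Qed.

(** The endpoint case of Hoelder's inequality: the second factor is almost surely
    bounded by some [M], so [M * f] dominates the product. *)
Lemma integrable_mul_Lfun1y (f g : T -> R) :
  f \in Lfun P 1%E -> g \in Lfun P +oo%E ->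
  P.-integrable setT (EFin \o (f \* g)).
Proof.
move=> fL gL; have [M gM] := Lfuny_bounded _ gL.
have mf := Lfun_measurable _ _ fL; have mg := Lfun_measurable _ _ gL.
have /integrableP[_ fMoo] : P.-integrable setT (fun t => (M%:E * (f t)%:E)%E).
  by apply: integrableZl => //; exact/Lfun1_integrable.
apply/integrableP; split; first exact/measurable_EFinP/measurable_funM.
apply: le_lt_trans fMoo; apply: ae_ge0_le_integral => //.
- apply: measurableT_comp => //; apply/measurable_EFinP.
  exact: measurable_funM.
- apply: measurableT_comp => //; apply/measurable_EFinP.
  exact: measurable_funM.
apply: filterS gM => t gtM _.
rewrite /= lee_fin mulrC !normrM ler_wpM2r// (le_trans gtM)//.
exact: ler_norm.
Qed.

(** Conjugacy leaves the two exponents both finite, or one of them [1] and the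
    other infinite. *)
Lemma integrable_mul_Lfun (p q : \bar R) (f g : T -> R) :
  (1 <= p)%E -> (1 <= q)%E -> (p^-1 + q^-1 = 1)%E ->
  f \in Lfun P p -> g \in Lfun P q ->
  P.-integrable setT (EFin \o (f \* g)).
Proof.
case: p => [r| |]; case: q => [s| |]//.
- rewrite !lee_fin => r1 s1.
  have r0 : 0 < r by rewrite (lt_le_trans ltr01).
  have s0 : 0 < s by rewrite (lt_le_trans ltr01).
  rewrite !inver !gt_eqF// -EFinD => -[rs] fL gL.
  have mf := Lfun_measurable _ _ fL; have mg := Lfun_measurable _ _ gL.
  apply/integrableP; split; first exact/measurable_EFinP/measurable_funM.
  rewrite -Lnorm1; apply: le_lt_trans (hoelder _ mf mg r0 s0 rs) _.
  by apply: lte_mul_pinfty; rewrite ?Lnorm_ge0//;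
    [rewrite ge0_fin_numE ?Lnorm_ge0//|]; exact: Lfun_finite_norm.
- move=> _ _; rewrite invey adde0 => /eqP; rewrite inve_eq1 => /eqP ->.
  exact: integrable_mul_Lfun1y.
- move=> _ _; rewrite invey add0e => /eqP; rewrite inve_eq1 => /eqP -> fL gL.
  rewrite (_ : _ \* _ = g \* f); first exact: integrable_mul_Lfun1y.
  by apply/funext => t /=; rewrite mulrC.
- by move=> _ _; rewrite !invey adde0 => -[/esym/eqP]; rewrite oner_eq0.
Qed.

End Lfun_product.

(** * Convergence for the pairing topology *)

Section sigma_convergence.
Context {disp : measure_display} {T : measurableType disp} {R : realType}.
Variables (P : probability T R) (p q : \bar R).
Hypotheses (p1 : (1 <= p)%E) (q1 : (1 <= q)%E) (pq : (p^-1 + q^-1 = 1)%E).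
Context {d : nat}.

Lemma measurable_pairing (xi : Lvec P p1 d) (zeta : Lvec P q1 d) :
  measurable_fun setT (fun t => (\sum_i xi t 0 i * zeta t 0 i)%:E).
Proof.
apply/measurable_EFinP; apply: measurable_sum => i.
by apply: measurable_funM; apply: Lfun_measurable;
  exact: Lvec_coord_subproof.
Qed.

(** Dominated convergence in the pairing with a fixed [zeta], the dominating
    function being the sum of the [|xi_i zeta_i|]. *)
Lemma cvg_sigma_dominated (xi_ : nat -> Lvec P p1 d) (xi : Lvec P p1 d) :
  (forall n t i, `|xi_ n t 0 i| <= `|xi t 0 i|) ->
  (forall t i, xi_ n t 0 i @[n --> \oo] --> xi t 0 i) ->
  xi_ @ \oo --> (xi : sigma_topology P p1 q1 d).
Proof.
move=> xi_le xi_cvg; apply: cvg_initial; apply: cvg_ptws => zeta.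
pose g t := (\sum_i `|xi t 0 i * zeta t 0 i|%:E)%E.
have g_int : P.-integrable setT g.
  apply: integrable_sum => // i _.
  apply: (integrable_norm (f := fun t => xi t 0 i * zeta t 0 i)).
  by apply: (integrable_mul_Lfun _ _ _ _ _ p1 q1 pq);
    exact: Lvec_coord_subproof.
pose f_ n t := (\sum_i xi_ n t 0 i * zeta t 0 i)%:E.
pose f t := (\sum_i xi t 0 i * zeta t 0 i)%:E.
have f_cvg : {ae P, forall t, setT t -> f_ n t @[n --> \oo] --> f t}.
  apply/aeW => t _; apply: cvg_EFin; first by near=> n.
  apply: cvg_big => [|i _]; first exact: add_continuous.
  by apply: cvgM; [exact: xi_cvg|exact: cvg_cst].
have f_g : {ae P, forall t n, setT t -> (`|f_ n t| <= g t)%E}.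
  apply/aeW => t n _; rewrite /g sumEFin abse_EFin lee_fin.
  apply: le_trans (ler_norm_sum _ _ _) _; apply: ler_sum => i _.
  by rewrite !normrM ler_wpM2r.
have [f_int _ cvg_int] := @dominated_convergence _ _ _ P setT measurableT
  f_ f g (fun n => measurable_pairing (xi_ n) zeta) (measurable_pairing xi zeta)
  f_cvg g_int f_g.
rewrite /Lvec_pairing unlock; apply: fine_cvg.
by rewrite fineK//; exact: integrable_fin_num.
Unshelve. all: by end_near. Qed.

Definition Lvec_truncate_fun (xi : Lvec P p1 d) (n : nat) t : 'rV[R]_d :=
  \row_i truncate n%:R (xi t 0 i).

Lemma Lvec_truncate_subproof xi n : Lvec_truncate_fun xi n \in Lvec_pred P p.
Proof.
apply/(Lvec_predP P p1) => i.
have xiL := Lvec_coord_subproof xi i.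
have mxi := Lfun_measurable _ _ _ xiL.
have nxi := Lfun_finite_norm _ _ _ xiL.
have mtr : measurable_fun setT (fun t => Lvec_truncate_fun xi n t 0 i).
  under eq_fun do rewrite mxE.
  by apply: measurable_maxr => //; exact: measurable_minr.
rewrite inE; apply/andP; rewrite !inE; split => //=.
apply: (le_finite_norm p1 mtr mxi _ nxi) => t.
by rewrite mxE norm_truncate_le.
Qed.

Definition Lvec_truncate (xi : Lvec P p1 d) (n : nat) : Lvec P p1 d :=
  MkLvec p1 (Lvec_truncate_subproof xi n).

Lemma cvg_Lvec_truncate (xi : Lvec P p1 d) :
  Lvec_truncate xi @ \oo --> (xi : sigma_topology P p1 q1 d).
Proof.
apply: cvg_sigma_dominated => [n t i|t i].
  by rewrite mxE norm_truncate_le.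
by under eq_fun do rewrite mxE; exact: cvg_truncate.
Qed.

End sigma_convergence.

(** * A coordinate of the expectation sees only that coordinate *)

Section coordinates.
Context {disp : measure_display} {T : measurableType disp} {R : realType}.
Variables (P : probability T R) (p q : \bar R).
Hypotheses (p1 : (1 <= p)%E) (q1 : (1 <= q)%E) (pq : (p^-1 + q^-1 = 1)%E).
Context {d : nat}.
Variable e : Lvec P p1 d -> 'rV[R]_d.
Hypothesis e_vse : vector_sublinear_expectation e.

(** The lower bound is subadditivity for [xi = (xi + x) + (- x)]. *)
Lemma vse_translation xi x i :
  e (xi + Lvec_cst P p1 x) 0 i = e xi 0 i + x 0 i.
Proof.
apply/eqP; rewrite eq_le; apply/andP; split.
  by have := vse_subadd e_vse xi (Lvec_cst P p1 x) i; rewrite (vse_cst e_vse).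
have := vse_subadd e_vse (xi + Lvec_cst P p1 x) (Lvec_cst P p1 (- x)) i.
rewrite (vse_cst e_vse) mxE -lerBlDr opprK.
rewrite (_ : _ + _ + _ = xi)//.
by apply/val_inj/funext => t /=; rewrite addrK.
Qed.

Hypothesis e_lsc : forall i : 'I_d, lower_semicontinuous
  (fun xi : sigma_topology P p1 q1 d => (e xi 0 i)%:E).

(** Boundedness gives the inequality for truncations by comparison with a
    constant vector; semicontinuity removes the truncation. *)
Lemma vse_zero_coord_le0 (xi : Lvec P p1 d) i :
  (forall t, xi t 0 i = 0) -> e xi 0 i <= 0.
Proof.
move=> xi0; rewrite -lee_fin.
apply: (lower_semicontinuous_cvg_le _ _ _ _ (e_lsc i)
  (cvg_Lvec_truncate P p q p1 q1 pq xi)) => n.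
rewrite lee_fin.
(* A constant vector above the truncation of xi at level n; its i-th coordinate
   can be 0 because that of xi is. *)
pose x : 'rV[R]_d := \row_j (if j == i then 0 else n%:R).
have -> : 0 = e (Lvec_cst P p1 x) 0 i by rewrite (vse_cst e_vse) mxE eqxx.
apply: (vse_mono e_vse); apply/aeW => t j; rewrite !mxE.
have [->|_] := eqVneq j i.
  by rewrite xi0 truncate_id// normr0.
by apply: le_trans (ler_norm _) _; exact: norm_truncate_le_bound.
Qed.

(** The difference of the two vectors vanishes at coordinate [i], so subadditivity
    and the previous bound give both inequalities. *)
Lemma vse_eq_coord (xi eta : Lvec P p1 d) i :
  (forall t, xi t 0 i = eta t 0 i) -> e xi 0 i = e eta 0 i.
Proof.
have e_le (a b : Lvec P p1 d) : (forall t, a t 0 i = b t 0 i) ->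
    e a 0 i <= e b 0 i.
  move=> ab; have := vse_subadd e_vse b (a - b) i.
  rewrite addrC subrK => /le_trans; apply; rewrite gerDl.
  by apply: vse_zero_coord_le0 => t; rewrite /= !mxE ab subrr.
by move=> xe; apply/eqP; rewrite eq_le !e_le.
Qed.

End coordinates.

(** * The expectation on diagonal vectors *)

Section diagonal.
Context {disp : measure_display} {T : measurableType disp} {R : realType}.
Context {P : probability T R} {p : \bar R} {p1 : (1 <= p)%E} (d : nat).

Lemma Lvec_diag_subproof (b : LfunType P p1) :
  (fun t => const_mx (b t) : 'rV[R]_d) \in Lvec_pred P p.
Proof.
apply/(Lvec_predP P p1) => i.
by under [X in X \in _]eq_fun do rewrite mxE; exact: LfunP.
Qed.

(** Repeating [b] in every coordinate, rather than completing it by zeros, sends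
    constants to constant vectors with equal coordinates and keeps the order, so
    the axioms transfer without a case analysis on the coordinate. *)
Definition Lvec_diag (b : LfunType P p1) : Lvec P p1 d :=
  MkLvec p1 (Lvec_diag_subproof b).

Lemma Lvec_diagD b b' : Lvec_diag (b + b') = Lvec_diag b + Lvec_diag b'.
Proof. by apply/val_inj/funext => t; apply/rowP => j; rewrite !mxE. Qed.

Lemma Lvec_diagZ c b : Lvec_diag (c *: b) = c *: Lvec_diag b.
Proof. by apply/val_inj/funext => t; apply/rowP => j; rewrite !mxE. Qed.

Lemma Lvec_diag_cst a :
  Lvec_diag (LfunType_cst P p1 a) = Lvec_cst P p1 (const_mx a).
Proof. exact/val_inj. Qed.

Lemma sublinear_expectation_diag (e : Lvec P p1 d -> 'rV[R]_d) i :
  vector_sublinear_expectation e ->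
  sublinear_expectation (fun b : LfunType P p1 => e (Lvec_diag b) 0 i).
Proof.
move=> e_vse; split=> [b a|b b' bb'|c b c0|b b'].
- by rewrite Lvec_diagD Lvec_diag_cst vse_translation// mxE.
- apply: (vse_mono e_vse); apply: filterS bb' => t bb' j.
  by rewrite !mxE.
- by rewrite Lvec_diagZ (vse_pos_homog e_vse)// mxE.
- by rewrite Lvec_diagD (vse_subadd e_vse).
Qed.

End diagonal.

Theorem theoremA1 (disp : measure_display) (T : measurableType disp)
    (R : realType) (P : probability T R) (p q : \bar R)
    (p1 : (1 <= p)%E) (q1 : (1 <= q)%E) (pq : (p^-1 + q^-1 = 1)%E)
    (d : nat) (e : Lvec P p1 d -> 'rV[R]_d) :
  vector_sublinear_expectation e ->
  (forall i : 'I_d, lower_semicontinuous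
     (fun xi : sigma_topology P p1 q1 d => (e xi 0 i)%:E)) ->
  exists es : 'I_d -> LfunType P p1 -> R,
    (forall i : 'I_d, sublinear_expectation (es i)) /\
    (forall xi : Lvec P p1 d, e xi = \row_(i < d) es i (Lvec_coord xi i)).
Proof.
move=> e_vse e_lsc; exists (fun i b => e (Lvec_diag d b) 0 i); split=> [i|xi].
  exact: sublinear_expectation_diag.
apply/rowP => i; rewrite [RHS]mxE.
by apply: (vse_eq_coord _ _ _ p1 q1 pq _ e_vse e_lsc) => t; rewrite mxE.
Qed.
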